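(* Let $\mathbb F$ be a field, $n\geqslant 1$ an integer, $a_0,\dots,a_n\in\mathbb F$ with $a_0a_n\neq 0$, and $c=(c_k)_{k\in\mathbb Z}$ with $c_k\in\mathbb F$. Consider the problem of finding $x=(x_k)_{k\in\mathbb Z}$ with $x_k\in\mathbb F$ such that $$\sum_{l=0}^n a_l x_{k+l}=c_k,\quad k\in\mathbb Z;\qquad x_j=0,\quad j=0,\dots,n-1.$$ Let $y_1,\dots,y_n$ be the solutions $y_i=(y_{i,k})_{k\in\mathbb Z}$ in $\mathbb F$ of the homogeneous recurrence $\sum_{l=0}^n a_l x_{k+l}=0$, $k\in\mathbb Z$, determined by $y_{i,j}=1$ if $j=i-1$ and $y_{i,j}=0$ if $j\neq i-1$, for $i\in\{1,\dots,n\}$, $j\in\{0,\dots,n-1\}$. For $k,j\in\mathbb Z$ put $$\widetilde H_{k,j}:=\begin{vmatrix} y_{1,k}&\cdots&y_{n,k}\\ y_{1,j+1}&\cdots&y_{n,j+1}\\ y_{1,j+2}&\cdots&y_{n,j+2}\\ \vdots&\ddots&\vdots\\ y_{1,j+n-1}&\cdots&y_{n,j+n-1}\end{vmatrix},\qquad C_j:=\widetilde H_{j,j},$$ and $$H_{k,j}:=\begin{cases}\dfrac{(-1)^{n-1}}{a_nC_{j+1}}\widetilde H_{k,j}, & (k,j)\in A_1,\\[2mm] \dfrac{1}{a_0C_j}\widetilde H_{k,j}, & (k,j)\in A_2,\\[2mm] 0, & (k,j)\in A_3\sqcup A_4.\end{cases}$$ Then the problem has a unique solution $u=(u_k)_{k\in\mathbb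 Z}$ with values in $\mathbb F$, and it is given by $$u_k=\sum_{j\in\mathbb Z}H_{k,j}c_j\in\mathbb F,\qquad k\in\mathbb Z,$$ where $H_{k,j}\in\mathbb F$ for all $k,j\in\mathbb Z$.
   Context: The sets $A_1,\dots,A_4$ are the following disjoint subsets whose union is $\mathbb Z^2$: $A_1=\{(k,j)\in\mathbb Z^2: k>j\geqslant 0\}$, $A_2=\{(k,j)\in\mathbb Z^2: k+1-n\leqslant j<0\}$, $A_3=\{(k,j)\in\mathbb Z^2: k+1-n>j,\ j<0\}$, $A_4=\{(k,j)\in\mathbb Z^2: k\leqslant j,\ j\geqslant 0\}$. The determinant $\widetilde H_{k,j}$ is $n\times n$: its first row is evaluated at index $k$ and its remaining $n-1$ rows at $j+1,\dots,j+n-1$ (for $n=1$ it is just $y_{1,k}$). The family $(H_{k,j})$ is called the Green's function and $C_j$ the Casorati determinant. *)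

(* Defs.v *)
From mathcomp Require Import all_boot all_order all_algebra.
From mathcomp Require Import boolp classical_sets functions cardinality fsbigop.
From mathcomp Require Import zify.

Set Implicit Arguments.
Unset Strict Implicit.
Unset Printing Implicit Defensive.

Import Order.TTheory GRing.Theory Num.Theory.
Local Open Scope ring_scope.

Definition recurrence (F : fieldType) (n : nat) (a : 'I_n.+1 -> F)
    (c x : int -> F) : Prop :=
  forall k : int, \sum_(l < n.+1) a l * x (k + l%:Z) = c k.

Definition is_solution (F : fieldType) (n : nat) (a : 'I_n.+1 -> F)
    (c x : int -> F) : Prop :=
  recurrence a c x /\ (forall j : 'I_n, x j%:Z = 0).

(* The family is indexed from 0: [y i] is the mathematical y_{i+1}, so that
   the condition "y_{i,j} = 1 iff j = i - 1" becomes "iff j = i". *)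
Definition fundamental_system (F : fieldType) (n : nat) (a : 'I_n.+1 -> F)
    (y : 'I_n -> int -> F) : Prop :=
  (forall i : 'I_n, recurrence a (fun=> 0) (y i)) /\
  (forall i j : 'I_n, y i j%:Z = (i == j)%:R).

Definition Htilde (F : fieldType) (n : nat) (y : 'I_n -> int -> F)
    (k j : int) : F :=
  \det (\matrix_(r < n, s < n)
          y s (if (r == 0 :> nat)%N then k else j + r%:Z)).

Definition casorati (F : fieldType) (n : nat) (y : 'I_n -> int -> F)
    (j : int) : F := Htilde y j j.

Definition A1 (k j : int) : bool := (j < k) && (0 <= j).
Definition A2 (n : nat) (k j : int) : bool := (k + 1 - n%:Z <= j) && (j < 0).
Definition A3 (n : nat) (k j : int) : bool := (j < k + 1 - n%:Z) && (j < 0).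
Definition A4 (k j : int) : bool := (k <= j) && (0 <= j).

(* The last branch is taken exactly on the union of A3 and A4; see [A34E]. *)
Definition green (F : fieldType) (n : nat) (a : 'I_n.+1 -> F)
    (y : 'I_n -> int -> F) (k j : int) : F :=
  if A1 k j then (-1) ^+ n.-1 / (a ord_max * casorati y (j + 1)) * Htilde y k j
  else if A2 n k j then 1 / (a ord0 * casorati y j) * Htilde y k j
  else 0.

Lemma A12_disjoint (n : nat) (k j : int) : ~~ (A1 k j && A2 n k j).
Proof. rewrite /A1 /A2; lia. Qed.

Lemma A34E (n : nat) (k j : int) : A3 n k j || A4 k j = ~~ (A1 k j || A2 n k j).
Proof. rewrite /A1 /A2 /A3 /A4; lia. Qed.

(* Division is total, so that the values H_{k,j} really are given by the
   displayed formulas is expressed by the nonvanishing of the denominators. *)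
Definition green_well_defined (F : fieldType) (n : nat) (a : 'I_n.+1 -> F)
    (y : 'I_n -> int -> F) : Prop :=
  forall k j : int,
    (A1 k j -> a ord_max * casorati y (j + 1) != 0) /\
    (A2 n k j -> a ord0 * casorati y j != 0).

(* Main.v *)
Require Import Defs.
From mathcomp Require Import all_boot all_order all_algebra.
From mathcomp Require Import boolp classical_sets functions cardinality fsbigop.
From mathcomp Require Import zify.

Set Implicit Arguments.
Unset Strict Implicit.
Unset Printing Implicit Defensive.

Import Order.TTheory GRing.Theory Num.Theory.
Local Open Scope classical_set_scope.
Local Open Scope ring_scope.

(** Since [a ord0] and [a ord_max] are both nonzero, the recurrence can be
    solved for either of its extreme terms, so a solution is determined by any
    [n] consecutive values ([recurrence_eq0], [recurrence_inj]). This gives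
    every uniqueness claim. It also gives the nonvanishing of the Casorati
    determinants: a linear relation between the columns of [casorati y j] is a
    combination of the [y i] that vanishes at [n] consecutive places, hence
    everywhere, and its values at 0, ..., n-1 are its coefficients
    ([casorati_neq0]). The fundamental system exists because the powers, of
    either sign, of the companion matrix of the recurrence satisfy the
    recurrence by Cayley-Hamilton ([exists_fundamental_system]).

    The rest is superposition: it suffices that each column [green a y ^~ j]
    solves the problem whose right-hand side is the unit impulse at [j]
    ([recurrence_green], [green_init]). As a function of [k], [Htilde y k j] is
    a combination of the [y i], hence a solution of the homogeneous recurrence,
    and it vanishes for [j < k < j + n] because two rows coincide. On this gap
    of [n - 1] zeros a multiple of [Htilde] can be glued to the zero sequence:
    zero on the left and [Htilde] on the right if [j] is nonnegative, the other
    way round if [j] is negative. Every window of [n + 1] consecutive indices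
    other than [j, ..., j + n] meets only one of the two pieces up to entries in
    the gap, so the glued sequence satisfies the homogeneous recurrence at every
    index except [j]. There a single term survives, [Htilde y (j + n) j], which
    is a signed Casorati determinant ([Htilde_cycle]), or [Htilde y j j]; the
    factors in front of [Htilde] normalize the result to 1. Putting the zero
    half-line on the side of 0 makes the initial values vanish and leaves
    finitely many nonzero [green a y k j] for each [k].

    Comments on lemmas about ['I_m.+1] or ['I_m.+2] write [n] for [m.+1]. *)

(** * Linear recurrences on the integers *)

Section LinearRecurrence.

Variables (F : fieldType) (n : nat) (a : 'I_n.+1 -> F).

Lemma recurrence_lincomb (I : Type) (r : seq I) (v : I -> F)
    (c x : I -> int -> F) :
  (forall i, recurrence a (c i) (x i)) ->
  recurrence a (fun k => \sum_(i <- r) v i * c i k)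
               (fun k => \sum_(i <- r) v i * x i k).
Proof.
move=> rec_x k.
under eq_bigr => l _ do rewrite big_distrr /=.
rewrite exchange_big /=; apply: eq_bigr => i _.
by rewrite -rec_x big_distrr /=; apply: eq_bigr => l _; rewrite mulrCA.
Qed.

Lemma recurrence_lincomb0 (I : Type) (r : seq I) (v : I -> F)
    (x : I -> int -> F) :
  (forall i, recurrence a (fun=> 0) (x i)) ->
  recurrence a (fun=> 0) (fun k => \sum_(i <- r) v i * x i k).
Proof.
move=> rec_x k; rewrite (recurrence_lincomb r v rec_x) big1 // => i _.
exact: mulr0.
Qed.

Lemma recurrenceB (c x x' : int -> F) :
  recurrence a c x -> recurrence a c x' ->
  recurrence a (fun=> 0) (fun k => x k - x' k).
Proof.
move=> rec_x rec_x' k; under eq_bigr => l _ do rewrite mulrBr.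
by rewrite sumrB rec_x rec_x' subrr.
Qed.

Lemma recurrence_only_first (c x : int -> F) (k : int) :
  recurrence a c x -> (forall l : 'I_n, x (k + l.+1%:Z) = 0) ->
  a ord0 * x k = c k.
Proof.
move=> rec_x x0; rewrite -rec_x big_ord_recl addr0 [X in _ + X]big1 ?addr0 //.
by move=> l _; rewrite lift0 x0 mulr0.
Qed.

Lemma recurrence_only_last (c x : int -> F) (k : int) :
  recurrence a c x -> (forall l : 'I_n, x (k + l%:Z) = 0) ->
  a ord_max * x (k + n%:Z) = c k.
Proof.
move=> rec_x x0; rewrite -rec_x big_ord_recr /= big1 ?add0r // => l _.
by rewrite x0 mulr0.
Qed.

Hypothesis a0an : a ord0 * a ord_max != 0.

Let a0_neq0 : a ord0 != 0.
Proof. by move: a0an; rewrite mulf_eq0 negb_or => /andP[]. Qed.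

Let an_neq0 : a ord_max != 0.
Proof. by move: a0an; rewrite mulf_eq0 negb_or => /andP[]. Qed.

Hypothesis n_gt0 : (0 < n)%N.

(** A block of [n] zeros propagates one step to the right because the leading
    coefficient is nonzero, and one step to the left because the trailing one
    is. *)
Lemma recurrence_eq0 (x : int -> F) (j : int) :
  recurrence a (fun=> 0) x -> (forall i : 'I_n, x (j + i%:Z) = 0) ->
  forall k, x k = 0.
Proof.
move=> rec_x.
pose P k := forall i : 'I_n, x (k + i%:Z) = 0.
have fwd k : P k -> P (k + 1).
  move=> Pk i; have [lt_in|le_ni] := ltnP i.+1 n.
    by have := Pk (Ordinal lt_in); congr (x _ = 0); rewrite /=; lia.
  have /eqP := recurrence_only_last rec_x Pk.
  rewrite mulf_eq0 (negPf an_neq0) => /eqP.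
  by congr (x _ = 0); have := ltn_ord i; lia.
have bwd k : P (k + 1) -> P k.
  move=> Pk; have x_tail (l : 'I_n) : x (k + l.+1%:Z) = 0.
    by have := Pk l; congr (x _ = 0); lia.
  case=> [[|i] lt_in] /=; last exact: (x_tail (Ordinal (ltnW lt_in))).
  have /eqP := recurrence_only_first rec_x x_tail.
  by rewrite mulf_eq0 (negPf a0_neq0) addr0 => /eqP.
move=> Pj k; rewrite -(subrK j k) addrC; move: (k - j) => d.
suff: P (j + d) by move=> /(_ (Ordinal n_gt0)); rewrite /= addr0.
elim/int_rect: d => [|d IHd|d IHd]; first by move: Pj; rewrite /P addr0.
- by move: (fwd _ IHd); congr (P _); lia.
- by apply: bwd; move: IHd; congr (P _); lia.
Qed.

Lemma recurrence_inj (c x x' : int -> F) :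
  recurrence a c x -> recurrence a c x' ->
  (forall i : 'I_n, x i%:Z = x' i%:Z) -> x = x'.
Proof.
move=> rec_x rec_x' eq_init; apply/funext => k; apply/eqP.
rewrite -subr_eq0; apply/eqP.
apply: (recurrence_eq0 (j := 0) (recurrenceB rec_x rec_x')) => i /=.
by rewrite add0r eq_init subrr.
Qed.

End LinearRecurrence.

(** * Existence of the fundamental system *)

(** Gives [companionmx p] the size [m], which is only propositionally equal to
    the [(size p).-1] of its type. *)
Lemma exists_companion (F : fieldType) (m : nat) (p : {poly F}) :
  p \is monic -> size p = m.+1 ->
  exists A : 'M[F]_m, char_poly A = p /\
    forall i j : 'I_m, (i.+1 < m)%N -> A i j = (i.+1 == j :> nat)%:R.
Proof.
move=> mon_p sz_p; have -> : m = (size p).-1 by rewrite sz_p.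
exists (companionmx p); split; first exact: companionmxK.
move=> i j lt_im; rewrite mxE; case: eqP => // eq_i.
have := ltn_predK lt_im; move: lt_im; rewrite eq_i => lt_d eq_d.
by rewrite eq_d ltnn in lt_d.
Qed.

(** With [A] the companion matrix of the normalized recurrence polynomial, the
    polynomial annihilates [A], and multiplying by [A ^ k] shows that each entry
    of [A ^ k] satisfies the recurrence in [k]. The top row of [A ^ j] is the
    [j]-th basis vector for [j < n], so this row provides the solutions. *)
Lemma exists_fundamental_system (F : fieldType) (m : nat) (a : 'I_m.+2 -> F) :
  a ord0 * a ord_max != 0 ->
  exists y : 'I_m.+1 -> int -> F, fundamental_system a y.
Proof.
rewrite mulf_eq0 negb_or => /andP[a0_neq0 an_neq0].
pose p := \poly_(l < m.+2) (a (inord l) / a ord_max).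
have lead_p : a (inord m.+1) / a ord_max = 1.
  rewrite (_ : inord _ = ord_max) ?divff //.
  by apply/val_inj; rewrite /= inordK.
have sz_p : size p = m.+2 by rewrite size_poly_eq // lead_p oner_eq0.
have mon_p : p \is monic.
  by rewrite monicE lead_coefE sz_p coef_poly ltnSn lead_p.
have [A [char_A shift_A]] := exists_companion mon_p sz_p.
have annul_A : \sum_(l < m.+2) a l *: A ^+ l = 0.
  have := Cayley_Hamilton A; rewrite char_A /p poly_def linear_sum /=.
  move=> /(congr1 (fun B => a ord_max *: B)); rewrite scaler0 => eq0.
  rewrite -[RHS]eq0 scaler_sumr; apply: eq_bigr => l _.
  rewrite horner_mxZ rmorphXn /= horner_mx_X scalerA inord_val.
  by rewrite mulrC divfK.
(* Isolating the constant term of the annihilating polynomial exhibits the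
   inverse of [A]; this is where [a ord0 != 0] is used. *)
have unit_A : A \is a GRing.unit.
  move: annul_A; rewrite big_ord_recl expr0.
  under eq_bigr => l _ do rewrite lift0 exprS scalerAr.
  rewrite -mulr_sumr => /eqP; rewrite addrC addr_eq0 => /eqP defA.
  set B := \sum_(l < _) _ in defA.
  have AB1 : A *m (- (a ord0)^-1 *: B) = 1%:M.
    rewrite -scalemxAr [A *m B]defA.
    by rewrite scaleNr scalerN opprK scalerA mulVf // scale1r.
  by have [] := mulmx1_unit AB1.
exists (fun s k => (A ^ k) ord0 s); split=> [s k|s j].
  transitivity ((A ^ k * \sum_(l < m.+2) a l *: A ^+ l) ord0 s).
    rewrite mulr_sumr summxE; apply: eq_bigr => l _.
    by rewrite -scalerAr mxE exprzDr.
  by rewrite annul_A mulr0 mxE.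
rewrite -exprnP; case: j => j /=; elim: j s => [|j IHj] s lt_j.
  by rewrite expr0 mxE eq_sym.
(* Multiplying the [j]-th basis row by [A] extracts row [j] of [A], which is
   the next basis row as long as [j] is not the last index. *)
pose j' := Ordinal (ltnW lt_j : (j < m.+1)%N).
have rowAj t : (A ^+ j) ord0 t = (t == j')%:R := IHj t (ltnW lt_j).
rewrite exprSr mxE (bigD1 j') //= rowAj eqxx mul1r shift_A //.
rewrite big1 ?addr0 => [|t /negPf ne_tj]; last by rewrite rowAj ne_tj mul0r.
by rewrite -val_eqE eq_sym.
Qed.

(** * The determinants Htilde *)

(** Laplace expansions of both determinants along the moved row have the same
    minors; the signs of the cofactors differ by the [m] places it moved. *)
Lemma det_cycle_rows (R : comNzRingType) (m : nat) (A B : 'M[R]_m.+1) :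
  row ord0 A = row ord_max B -> row' ord0 A = row' ord_max B ->
  \det A = (-1) ^+ m * \det B.
Proof.
move=> eq_row eq_row'.
rewrite (expand_det_row A ord0) (expand_det_row B ord_max) big_distrr /=.
apply: eq_bigr => s _; have /rowP/(_ s) := eq_row; rewrite !mxE => ->.
have eq_minor : row' ord0 (col' s A) = row' ord_max (col' s B).
  apply/matrixP => r t; have /matrixP/(_ r (lift s t)) := eq_row'.
  by rewrite !mxE.
rewrite /cofactor eq_minor [RHS]mulrCA; congr (_ * _).
rewrite [RHS]mulrA; congr (_ * _).
rewrite add0n exprD mulrA -exprD addnn -mul2n exprM sqrrN.
by rewrite !expr1n mul1r.
Qed.

Section Green.

Variables (F : fieldType) (m : nat) (a : 'I_m.+2 -> F).
Variable y : 'I_m.+1 -> int -> F.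

(** The rows of index 0 and [k - j] coincide. *)
Lemma Htilde_eq0 (k j : int) : j < k < j + m.+1%:Z -> Htilde y k j = 0.
Proof.
move=> kj; have [d def_d] : exists d : nat, k = j + d.+1%:Z.
  by exists `|(k - j - 1)%R|%N; lia.
have lt_d : (d.+1 < m.+1)%N by lia.
apply: (@determinant_alternate _ _ _ ord0 (Ordinal lt_d)) => // s.
by rewrite !mxE /= def_d.
Qed.

Lemma Htilde_cycle (j : int) :
  Htilde y (j + m.+1%:Z) j = (-1) ^+ m * casorati y (j + 1).
Proof.
apply: det_cycle_rows.
  apply/rowP => s; rewrite !mxE /=; congr (y s _).
  by case: eqP => [->|_]; lia.
apply/matrixP => r s; rewrite !mxE /=; congr (y s _).
have -> : bump m r = r :> nat by rewrite /bump leqNgt ltn_ord.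
by case: eqP => [->|_] /=; rewrite /bump; lia.
Qed.

(** * The Green's function, column by column *)

Lemma green_nonneg_gt (k j : int) : 0 <= j -> j < k ->
  green a y k j = (-1) ^+ m / (a ord_max * casorati y (j + 1)) * Htilde y k j.
Proof. by move=> j_ge0 lt_jk; rewrite /green /A1 lt_jk j_ge0. Qed.

(** Together with [green_nonneg_gt], this describes the column twice on the gap
    [j < k < j + n], as zero and as a multiple of [Htilde]; such an overlap is
    what lets a window of [n + 1] indices always be treated by one formula. *)
Lemma green_nonneg_eq0 (k j : int) : 0 <= j -> k < j + m.+1%:Z ->
  green a y k j = 0.
Proof.
move=> j_ge0 lt_k; have [lt_jk|le_kj] := ltP j k.
  by rewrite green_nonneg_gt // Htilde_eq0 ?mulr0 // lt_jk.
by rewrite /green /A1 /A2 ltNge le_kj ltNge j_ge0 andbF.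
Qed.

Lemma green_neg_lt (k j : int) : j < 0 -> k < j + m.+1%:Z ->
  green a y k j = 1 / (a ord0 * casorati y j) * Htilde y k j.
Proof.
move=> j_lt0 lt_k; rewrite /green ifF; last by rewrite /A1; lia.
by rewrite ifT // /A2; lia.
Qed.

Lemma green_neg_eq0 (k j : int) : j < 0 -> j < k -> green a y k j = 0.
Proof.
move=> j_lt0 lt_jk; have [lt_k|le_k] := ltP k (j + m.+1%:Z).
  by rewrite green_neg_lt // Htilde_eq0 ?mulr0 // lt_jk.
by rewrite /green !ifF // /A1 /A2; lia.
Qed.

(** The zero half-line of each column contains 0, ..., n-1. *)
Lemma green_init (j : int) (i : 'I_m.+1) : green a y i%:Z j = 0.
Proof.
have lt_i := ltn_ord i; have [j_ge0|j_lt0] := leP 0 j.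
  by rewrite green_nonneg_eq0 //; lia.
by rewrite green_neg_eq0 //; lia.
Qed.

Lemma green_support (k j : int) :
  green a y k j != 0 -> (`|j| <= `|k| + m.+1)%N.
Proof.
apply: contra_neqT => big_j; rewrite /green !ifF // /A1 /A2.
- apply/negP; lia.
- apply/negP; lia.
Qed.

Hypothesis a0an : a ord0 * a ord_max != 0.
Hypothesis fund_y : fundamental_system a y.

(** A vanishing determinant yields a combination of the [y i] with [n]
    consecutive zeros, hence zero, whose coefficients are read off from its
    values at 0, ..., n-1. *)
Lemma casorati_neq0 (j : int) : casorati y j != 0.
Proof.
rewrite /casorati /Htilde -det_tr; apply/det0P => -[v v_neq0 vM0].
have rec_x := recurrence_lincomb0 (index_enum _) (v ord0) fund_y.1.
move/negP: v_neq0; apply; apply/eqP/rowP => s; rewrite mxE.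
have x_eq0 := recurrence_eq0 (j := j) a0an (ltn0Sn m) rec_x.
rewrite -[RHS](x_eq0 _ s%:Z) => [|i].
  under eq_bigr => t _ do rewrite fund_y.2.
  rewrite (bigD1 s) //= eqxx mulr1 big1 ?addr0 // => t /negPf->.
  by rewrite mulr0.
have /rowP/(_ i) := vM0; rewrite !mxE => vM0i; rewrite -[RHS]vM0i.
apply: eq_bigr => t _.
by rewrite !mxE; case: eqP => // ->; rewrite addr0.
Qed.

(** Only the first row depends on [k], so the expansion along it is a
    combination of the [y s] with constant coefficients. *)
Lemma recurrence_Htilde (j : int) : recurrence a (fun=> 0) (Htilde y ^~ j).
Proof.
(* These cofactors ignore row 0, so any choice of that row gives the same
   value; here it is filled as for [k = j]. *)
pose cof s := cofactor (\matrix_(r < m.+1, s < m.+1) y s (j + r%:Z)) ord0 s.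
rewrite (_ : Htilde y ^~ j = fun k => \sum_s cof s * y s k).
  exact: recurrence_lincomb0 fund_y.1.
apply/funext => k; rewrite /Htilde (expand_det_row _ ord0).
apply: eq_bigr => s _; rewrite mxE eqxx mulrC; congr (_ * _).
rewrite /cof /cofactor; congr (_ * \det _).
by apply/matrixP => r t; rewrite !mxE.
Qed.

Lemma green_well_definedP : green_well_defined a y.
Proof.
move=> k j; move: a0an; rewrite mulf_eq0 negb_or => /andP[a0_neq0 an_neq0].
by split=> _; rewrite mulf_neq0 ?casorati_neq0.
Qed.

(** Away from [k = j] the whole window lies in one piece of the glued column.
    At [k = j] all terms vanish except the last one ([0 <= j]) or the first one
    ([j < 0]), which the prefactor normalizes. *)
Lemma recurrence_green (j : int) :
  recurrence a (fun k => (j == k)%:R) (green a y ^~ j).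
Proof.
move=> k; move: a0an; rewrite mulf_eq0 negb_or => /andP[a0_neq0 an_neq0].
have Htilde0 (b : F) : \sum_(l < m.+2) a l * (b * Htilde y (k + l%:Z) j) = 0.
  under eq_bigr => l _ do rewrite mulrCA.
  by rewrite -mulr_sumr recurrence_Htilde mulr0.
have [j_ge0|j_lt0] := leP 0 j.
- have [lt_jk|lt_kj|eq_jk] := ltgtP j k.
  + rewrite -[RHS](Htilde0 ((-1) ^+ m / (a ord_max * casorati y (j + 1)))).
    by apply: eq_bigr => l _; rewrite green_nonneg_gt //; lia.
  + rewrite big1 // => l _; rewrite green_nonneg_eq0 ?mulr0 //.
    by have := ltn_ord l; lia.
  + rewrite -eq_jk big_ord_recr /= big1 ?add0r => [|l _]; last first.
      by rewrite green_nonneg_eq0 ?mulr0 //; have := ltn_ord l; lia.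
    rewrite green_nonneg_gt ?Htilde_cycle //; last lia.
    rewrite mulrACA -expr2 sqrr_sign mul1r mulrCA.
    by rewrite mulVf ?mulf_neq0 ?casorati_neq0.
- have [lt_jk|lt_kj|eq_jk] := ltgtP j k.
  + by rewrite big1 // => l _; rewrite green_neg_eq0 ?mulr0 //; lia.
  + rewrite -[RHS](Htilde0 (1 / (a ord0 * casorati y j))).
    apply: eq_bigr => l _; rewrite green_neg_lt //.
    by have := ltn_ord l; lia.
  + rewrite -eq_jk big_ord_recl /= big1 ?addr0 => [|l _]; last first.
      by rewrite green_neg_eq0 ?mulr0 // /bump; lia.
    rewrite green_neg_lt //; last lia.
    by rewrite mul1r mulrCA mulVf ?mulf_neq0 ?casorati_neq0.
Qed.

End Green.

(** * Superposition *)

Definition centered_interval (N : nat) : seq int :=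
  [seq i%:Z - N%:Z | i <- iota 0 N.*2.+1].

Lemma centered_interval_uniq (N : nat) : uniq (centered_interval N).
Proof. by rewrite map_inj_uniq ?iota_uniq // => i j; lia. Qed.

Lemma mem_centered_interval (N : nat) (j : int) :
  (j \in centered_interval N) = (`|j| <= N)%N.
Proof.
apply/mapP/idP => [[i]|le_jN]; first by rewrite mem_iota; lia.
by exists `|(j + N%:Z)%R|%N; rewrite ?mem_iota; lia.
Qed.

Lemma fsum_seq (R : nmodType) (I : choiceType) (r : seq I) (f : I -> R) :
  uniq r -> (forall i, f i != 0 -> i \in r) ->
  \sum_(i \in [set: I]) f i = \sum_(i <- r) f i.
Proof.
move=> uniq_r supp_r; rewrite [RHS]fsbig_seq //.
apply/esym/fsbig_widen => // i /=.
by case=> _ /negP i_notin; apply/eqP; apply: contraNT i_notin => /supp_r.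
Qed.

Section Solution.

Variables (F : fieldType) (m : nat) (a : 'I_m.+2 -> F) (c : int -> F).
Variable y : 'I_m.+1 -> int -> F.
Hypothesis a0an : a ord0 * a ord_max != 0.
Hypothesis fund_y : fundamental_system a y.

Let u (k : int) : F := \sum_(j \in [set: int]) green a y k j * c j.

(** One truncation serves all the indices near a given one; this turns the
    recurrence for [u], which mentions finitely supported sums with varying
    supports, into an identity between sums over a common range. *)
Lemma green_sum_truncated (N : nat) (k : int) : (`|k| + m.+1 <= N)%N ->
  u k = \sum_(j <- centered_interval N) c j * green a y k j.
Proof.
move=> le_kN; under eq_bigr => j _ do rewrite mulrC.
apply: fsum_seq (centered_interval_uniq N) _ => j.
rewrite mulf_eq0 negb_or => /andP[/green_support le_j _].
by rewrite mem_centered_interval (leq_trans le_j).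
Qed.

Lemma is_solution_green_sum : is_solution a c u.
Proof.
split=> [k|i]; last first.
  rewrite (green_sum_truncated (leqnn _)) big1 // => j _.
  by rewrite green_init ?mulr0.
(* The second [m.+1] makes the interval large enough for all the indices
   [k + l] of the window, not just for [k]. *)
pose N := (`|k| + m.+1 + m.+1)%N.
have sum_trunc := recurrence_lincomb (centered_interval N) c
  (recurrence_green a0an fund_y) k.
transitivity (\sum_(j <- centered_interval N) c j * (j == k)%:R).
  rewrite -sum_trunc; apply: eq_bigr => l _.
  by rewrite (@green_sum_truncated N) //; have := ltn_ord l; rewrite /N; lia.
rewrite (bigD1_seq k) ?centered_interval_uniq //=; last first.
  by rewrite mem_centered_interval /N; lia.
by rewrite eqxx mulr1 big1 ?addr0 // => j /negPf->; rewrite mulr0.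
Qed.

End Solution.

(* [\sum_(j \in [set: int])] is the sum of a finitely supported family (it is 0
   by convention otherwise), hence the explicit finiteness of the support. *)
Theorem theorem3p2 (F : fieldType) (n : nat) (a : 'I_n.+1 -> F) (c : int -> F)
    (n_ge1 : (1 <= n)%N) (a0an : a ord0 * a ord_max != 0) :
  (exists! y : 'I_n -> int -> F, fundamental_system a y) /\
  (forall y : 'I_n -> int -> F, fundamental_system a y ->
     [/\ green_well_defined a y,
         forall k : int, finite_set [set j : int | green a y k j * c j != 0],
         exists! u : int -> F, is_solution a c u
       & forall u : int -> F, is_solution a c u ->
           forall k : int, u k = \sum_(j \in [set: int]) green a y k j * c j]).
Proof.
case: n n_ge1 a a0an => [//|m] _ a a0an; split.
  have [y fund_y] := exists_fundamental_system a0an.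
  exists y; split=> // z fund_z; apply/funext => i.
  apply: (recurrence_inj a0an (ltn0Sn m) (fund_y.1 i) (fund_z.1 i)) => j.
  by rewrite fund_y.2 fund_z.2.
move=> y fund_y; have sol := is_solution_green_sum c a0an fund_y.
have sol_uniq v w : is_solution a c v -> is_solution a c w -> v = w.
  move=> [rec_v v0] [rec_w w0].
  by apply: (recurrence_inj a0an (ltn0Sn m) rec_v rec_w) => i; rewrite v0 w0.
split=> [||| v sol_v k].
- exact: green_well_definedP.
- move=> k; apply: sub_finite_set (finite_seq (centered_interval (`|k| + m.+1))).
  move=> j /=; rewrite mulf_eq0 negb_or => /andP[/green_support le_j _].
  by rewrite mem_centered_interval.
- by eexists; split; [exact: sol|move=> v; exact: sol_uniq].
- by rewrite (sol_uniq _ _ sol_v sol).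
Qed.
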